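(* Let $N\ge1$ and let $\mathbf X=(X_t)_{t\in I}$ be a real Markov process that is $N$-TLI and $N$-MSC. Then $\mathbf X$ is $N$-MPR if and only if there exist $N$ martingales $(\mathcal M_i(t),\mathcal F_{\le t})_{t\in I}$, $i=1,\dots,N$, such that each $\mathcal M_i(t)$ is a polynomial in $X_t$ of degree $i$ (with coefficients depending on $t$). More precisely: if $\mathbf X$ is $N$-MPR with structural matrix $V_N(t)$, then the entries of the vector $V_N^{-1}(t)X_t^{(N)}$ are polynomial martingales with respect to $(\mathcal F_{\le t})$; conversely, if $W_N(t)$ is a non-singular lower triangular matrix such that the entries of $W_N(t)X_t^{(N)}$ are martingales with respect to $(\mathcal F_{\le t})$, then $E(X_t^{(N)}\mid\mathcal F_{\le s})=W_N^{-1}(t)W_N(s)X_s^{(N)}$ for $s\le t$, so $\mathbf X$ is $N$-MPR and $V_N(t)=W_N^{-1}(t)$ is a structural matrix of $\mathbf X$.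
   Context: $I=[l,r]$ is a finite or infinite segment of the real line. $\mathbf X$ has $E|X_t|^n<\infty$ for all $n$, $t$, and the support of the law of each $X_t$ is infinite. $\mathcal F_{\le s}=\sigma(X_v:v\in[l,s])$. $N$-TLI: for every $0<n\le N$ and $s\ne t$ in $I$, $[\operatorname{cov}(X_t^i,X_s^j)]_{i,j=1}^n$ is non-singular. $N$-MSC: $(t,s)\mapsto EX_t^mX_s^j$ is continuous at least on the diagonal for $m,j\le N$. $N$-MPR: Markov, $N$-TLI, $N$-MSC, and for $1\le n\le N$, $s\le t$, $E(X_t^n\mid\mathcal F_{\le s})=\sum_{k=0}^n\gamma_{n,k}(s,t)X_s^k$ a.s.; with $\gamma_{0,0}=1$, $\gamma_{i,j}=0$ for $j>i$, set $\mathcal A_N(s,t)=[\gamma_{i,j}(s,t)]_{i,j=0}^N$, so $E(X_t^{(N)}\mid\mathcal F_{\le s})=\mathcal A_N(s,t)X_s^{(N)}$ with $X_t^{(N)}=(1,X_t,\dots,X_t^N)^T$. A structural matrix of an $N$-MPR process is any family $\{V_N(t)\}_{t\in I}$ of non-singular lower triangular $(N+1)\times(N+1)$ matrices with $\mathcal A_N(s,u)=V_N(u)V_N^{-1}(s)$ for all $s\le u$. *)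

(* Defs.v *)
From HB Require Import structures.
From mathcomp Require Import all_boot all_order all_algebra.
From mathcomp Require Import all_classical all_reals all_analysis.
Unset Printing Implicit Defensive.
Import Order.TTheory GRing.Theory Num.Theory numFieldNormedType.Exports.
Local Open Scope classical_set_scope.
Local Open Scope ring_scope.

Section Defs.
Context {d : measure_display} {T : measurableType d} {R : realType}.
Variable P : probability T R.

Definition segment (l r : \bar R) : set R :=
  [set t : R | (l <= t%:E)%E /\ (t%:E <= r)%E].

(* expectation (used only on integrable functions) *)
Definition expct (f : T -> R) : R := fine (\int[P]_w (f w)%:E)%E.
Definition cov (U V : T -> R) : R :=
  expct (fun w => U w * V w) - expct U * expct V.

Definition sigma_gen (G : set (set T)) : set (set T) :=
  smallest (sigma_algebra setT) G.

Definition past (I : set R) (X : R -> T -> R) (s : R) : set (set T) :=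
  sigma_gen [set A | exists v (B : set R),
               [/\ I v, v <= s, measurable B & A = X v @^-1` B]].

Definition sigma_rv (Y : T -> R) : set (set T) :=
  sigma_gen [set A | exists B : set R, measurable B /\ A = Y @^-1` B].

Definition meas_wrt (F : set (set T)) (Y : T -> R) : Prop :=
  forall B : set R, measurable B -> F (Y @^-1` B).

Definition cexp_version (F : set (set T)) (Z Y : T -> R) : Prop :=
  [/\ meas_wrt F Y, P.-integrable setT (fun w => (Y w)%:E) &
      forall A, F A -> (\int[P]_(w in A) (Y w)%:E = \int[P]_(w in A) (Z w)%:E)%E].

Definition martingale (I : set R) (X : R -> T -> R) (M : R -> T -> R) : Prop :=
  (forall t, I t -> meas_wrt (past I X t) (M t) /\
                    P.-integrable setT (fun w => (M t w)%:E)) /\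
  (forall s t, I s -> I t -> s <= t -> cexp_version (past I X s) (M t) (M s)).

Definition law_support (Y : T -> R) : set R :=
  [set x | forall e : R, 0 < e -> (0 < P (Y @^-1` ball x e))%E].

Definition is_markov (I : set R) (X : R -> T -> R) : Prop :=
  forall s t, I s -> I t -> s <= t -> forall B : set R, measurable B ->
    exists Y : T -> R, cexp_version (past I X s) (\1_(X t @^-1` B)) Y /\
                       meas_wrt (sigma_rv (X s)) Y.

Definition TLI (N : nat) (I : set R) (X : R -> T -> R) : Prop :=
  forall n : nat, (0 < n <= N)%N -> forall s t, I s -> I t -> s != t ->
    (\matrix_(i < n, j < n) cov (fun w => X t w ^+ i.+1) (fun w => X s w ^+ j.+1))
      \in unitmx.

Definition MSC (N : nat) (I : set R) (X : R -> T -> R) : Prop :=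
  forall m j : nat, (m <= N)%N -> (j <= N)%N -> forall t, I t ->
    forall e : R, 0 < e -> exists2 del : R, 0 < del & forall u v, I u -> I v ->
      `|u - t| < del -> `|v - t| < del ->
      `|expct (fun w => X u w ^+ m * X v w ^+ j)
        - expct (fun w => X t w ^+ m * X t w ^+ j)| < e.

Definition mpr_coeffs (N : nat) (I : set R) (X : R -> T -> R)
    (gam : nat -> nat -> R -> R -> R) : Prop :=
  forall n : nat, (1 <= n <= N)%N -> forall s t, I s -> I t -> s <= t ->
    cexp_version (past I X s) (fun w => X t w ^+ n)
                 (fun w => \sum_(k < n.+1) gam n k s t * X s w ^+ k).

Definition MPR (N : nat) (I : set R) (X : R -> T -> R) : Prop :=
  [/\ is_markov I X, TLI N I X, MSC N I X & exists gam, mpr_coeffs N I X gam].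

Definition A_mx (N : nat) (gam : nat -> nat -> R -> R -> R) (s t : R)
    : 'M[R]_N.+1 :=
  \matrix_(i, j) if (i == 0 :> nat) then (j == 0 :> nat)%:R
                 else if (j <= i)%N then gam i j s t else 0.

Definition Xvec (N : nat) (X : R -> T -> R) (t : R) (w : T) : 'cV[R]_N.+1 :=
  \col_(i < N.+1) X t w ^+ i.

Definition lower_nonsing (N : nat) (M : 'M[R]_N.+1) : Prop :=
  M \in unitmx /\ is_trig_mx M.

Definition structural_matrix (N : nat) (I : set R) (X : R -> T -> R)
    (V : R -> 'M[R]_N.+1) : Prop :=
  (forall t, I t -> lower_nonsing N (V t)) /\
  exists gam, mpr_coeffs N I X gam /\
    forall s u, I s -> I u -> s <= u -> A_mx N gam s u = V u *m invmx (V s).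

End Defs.

(* Main.v *)
Require Import Defs.
From HB Require Import structures.
From mathcomp Require Import all_boot all_order all_algebra.
From mathcomp Require Import finmap ring.
From mathcomp Require Import all_classical all_reals all_analysis.
From mathcomp Require Import measurable_realfun.
Import Order.TTheory GRing.Theory Num.Theory numFieldNormedType.Exports.
Set Implicit Arguments.
Unset Strict Implicit.
Local Open Scope classical_set_scope.
Local Open Scope ring_scope.

(** Everything is read off conditional expectations of polynomials:
    [cexp_poly s t p q] means [E(q(X_t) | F_<=s) = p(X_s)].  A row vector [c]
    stands for the polynomial [rVpoly c], so that [cexp_mx s t M], i.e.
    [E(X_t^(N) | F_<=s) = M X_s^(N)], becomes the linear condition
    [E(c(X_t) | F_<=s) = (c M)(X_s)] for all [c].  Infinite support makes [M]
    unique, hence the tower property gives [A(s,u) = A(t,u) A(s,t)].  If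
    [c A(s,t) = 0] then [c(X_t)] is orthogonal to every polynomial in [X_s], and
    TLI forces [c = 0]; so [A(s,t)] is invertible, and fixing a base point [t0]
    the family [A(t0,t)] for [t >= t0], [A(t,t0)^-1] for [t < t0] is structural.
    The remaining claims amount to [c = (c W(t)^-1) W(t)]. *)

(** * Triangular matrices and the polynomials of their rows *)

(** Columns are cleared from right to left. In entry (i, j), i < j, of [invmx M *m M = 1], the terms
    with l < j vanish since [M] is triangular and those with l > j by induction. What is left is
    [invmx M i j * M j j = 0], where [M j j] is nonzero as a factor of the determinant. *)
Lemma invmx_trig (F : fieldType) (n : nat) (M : 'M[F]_n) :
  M \in unitmx -> is_trig_mx M -> is_trig_mx (invmx M).
Proof.
move=> uM tM; have /is_trig_mxP M0 := tM; apply/is_trig_mxP => i j.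
have [k] := ubnP (n - j); elim: k j => // k ih j nk ij.
have Mjj : M j j != 0.
  move: uM; rewrite unitmxE unitfE (det_trig tM).
  by apply: contra_neq => Mjj; rewrite (bigD1 j) //= Mjj mul0r.
have /matrixP/(_ i j) := mulVmx uM.
rewrite !mxE (bigD1 j) //= big1 => [|l lj]; last first.
  have [ll|ll] := ltnP l j; first by rewrite M0 // mulr0.
  have jl : (j < l)%N by rewrite ltn_neqAle ll eq_sym andbT.
  rewrite ih ?mul0r // ?(ltn_trans ij) //.
  by rewrite -ltnS (leq_trans _ nk) // ltnS ltn_sub2l.
have -> : (i == j) = false by apply/eqP => ije; rewrite ije ltnn in ij.
rewrite addr0 => /eqP; rewrite mulf_eq0 (negPf Mjj) orbF => /eqP.
exact.
Qed.

Lemma mulmx_trig (F : comRingType) (n : nat) (M K : 'M[F]_n) :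
  is_trig_mx M -> is_trig_mx K -> is_trig_mx (M *m K).
Proof.
move=> /is_trig_mxP M0 /is_trig_mxP K0; apply/is_trig_mxP => i j ij.
rewrite mxE big1 // => k _; have [ik|ki] := ltnP i k.
  by rewrite M0 ?mul0r.
by rewrite K0 ?mulr0 // (leq_ltn_trans ki).
Qed.

Lemma horner_rVpoly_sum (F : nzRingType) (n : nat) (c : 'rV[F]_n) (x : F) :
  (rVpoly c).[x] = \sum_(i < n) c 0 i * x ^+ i.
Proof.
by rewrite horner_poly; apply: eq_bigr => i _; rewrite valK.
Qed.

(** The leading coefficient is the diagonal entry, nonzero because the determinant is the product of
    the diagonal. *)
Lemma size_rVpoly_trig (F : fieldType) (n : nat) (M : 'M[F]_n) (i : 'I_n) :
  M \in unitmx -> is_trig_mx M -> size (rVpoly (row i M)) = i.+1.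
Proof.
move=> uM tM; have /is_trig_mxP M0 := tM.
apply/eqP; rewrite eqn_leq; apply/andP; split.
  apply/leq_sizeP => j ij; rewrite coef_rVpoly.
  by case: insubP => // k _ kj; rewrite mxE M0 // kj.
rewrite ltnNge; apply/negP => /(nth_default 0).
rewrite coef_rVpoly_ord mxE; apply/eqP.
move: uM; rewrite unitmxE unitfE (det_trig tM).
by apply: contra_neq => Mii; rewrite (bigD1 i) //= Mii mul0r.
Qed.

(** * Integrability and measurability of polynomials in the process *)

Section PolynomialMoments.
Context {d : measure_display} {T : measurableType d} {R : realType}.
Variables (P : probability T R) (I : set R) (X : R -> T -> R).
Hypothesis mX : forall t, I t -> measurable_fun setT (X t).
Hypothesis moments : forall t (n : nat), I t ->
  P.-integrable setT (fun w => (`|X t w| ^+ n)%:E).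

Lemma integrable_monomials (i j : nat) s t : I s -> I t ->
  P.-integrable setT (fun w => (X s w ^+ i * X t w ^+ j)%:E).
Proof.
move=> Is It.
have h := integrableD measurableT (moments (i * 2)%N Is) (moments (j * 2)%N It).
apply: le_integrable h => //.
  apply/measurable_EFinP; apply: measurable_funM;
  apply: measurable_funX; exact: mX.
move=> w _; rewrite -EFinD !abse_EFin lee_fin.
rewrite [leRHS]ger0_norm ?addr_ge0 ?exprn_ge0 //.
rewrite !exprM normrM !normrX.
set a := _ ^+ i; set b := _ ^+ j.
have a0 : 0 <= a by rewrite exprn_ge0.
have b0 : 0 <= b by rewrite exprn_ge0.
(* The bound is ab <= 2ab <= a^2 + b^2, the last inequality being (a - b)^2 >= 0. *)
have /le_trans : a * b <= a * b *+ 2 by rewrite mulr2n lerDl mulr_ge0.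
by apply; rewrite -subr_ge0 -addrAC -sqrrB sqr_ge0.
Qed.

Lemma integrable_polyM (p q : {poly R}) s t : I s -> I t ->
  P.-integrable setT (fun w => (p.[X s w] * q.[X t w])%:E).
Proof.
move=> Is It.
rewrite (_ : (fun w => _) = fun w => (\sum_(i < size p) \sum_(j < size q)
   ((p`_i * q`_j)%:E * (X s w ^+ i * X t w ^+ j)%:E))%E); last first.
  apply/funext => w; rewrite !horner_coef big_distrlr /= -sumEFin.
  apply: eq_bigr => i _; rewrite -sumEFin; apply: eq_bigr => j _.
  by rewrite -EFinM mulrACA.
apply: integrable_sum => // i _; apply: integrable_sum => // j _.
exact/integrableZl/integrable_monomials.
Qed.

Lemma integrable_poly (p : {poly R}) t : I t ->
  P.-integrable setT (fun w => (p.[X t w])%:E).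
Proof.
move=> It; have := integrable_polyM p 1 It It.
by under eq_fun do rewrite hornerE mulr1.
Qed.

Lemma past_sub_measurable s : past I X s `<=` measurable.
Proof.
apply: smallest_sub; first exact: sigma_algebra_measurable.
move=> _ [v [B [Iv _ mB ->]]]; rewrite -[_ @^-1` _]setTI.
exact: mX.
Qed.

Lemma past_mono s t : s <= t -> past I X s `<=` past I X t.
Proof.
move=> st; apply: sub_sigma_algebra2 => _ [v [B [Iv vs mB ->]]].
by exists v, B; split => //; exact: le_trans vs st.
Qed.

Lemma past_preimage s (B : set R) : I s -> measurable B ->
  past I X s (X s @^-1` B).
Proof. by move=> Is mB; apply: sub_sigma_algebra; exists s, B; split. Qed.

Lemma meas_wrt_poly (p : {poly R}) s : I s ->
  meas_wrt (past I X s) (fun w => p.[X s w]).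
Proof.
move=> Is B mB; apply: (past_preimage (B := horner p @^-1` B)) => //.
rewrite -[_ @^-1` _]setTI.
by apply: continuous_measurable_fun => // x; exact: continuous_horner.
Qed.

(** * Conditional expectations of polynomials *)

(** Only the averaging identity is recorded, with real-valued integrals so that linear algebra
    applies; [cexp_polyP] restores measurability and integrability, which polynomials in [X s]
    always have. *)
Definition cexp_poly (s t : R) (p q : {poly R}) : Prop :=
  forall A, past I X s A ->
    \int[P]_(w in A) p.[X s w] = \int[P]_(w in A) q.[X t w].

Lemma integrable_poly_in (p : {poly R}) t (A : set T) : I t -> measurable A ->
  P.-integrable A (EFin \o (fun w => p.[X t w])).
Proof. by move=> It mA; apply: integrableS (integrable_poly p It). Qed.

Lemma cexp_polyP s t (p q : {poly R}) : I s -> I t ->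
  cexp_version P (past I X s) (fun w => q.[X t w]) (fun w => p.[X s w])
    <-> cexp_poly s t p q.
Proof.
move=> Is It; split => [[_ _ h] A pA|h].
  by rewrite /Rintegral h.
split; [exact: meas_wrt_poly|exact: integrable_poly|].
move=> A pA; have mA := past_sub_measurable pA.
have := congr1 EFin (h _ pA).
by rewrite /Rintegral !fineK //; apply: integrable_fin_num => //;
  exact: integrable_poly_in.
Qed.

Lemma cexp_poly_linear s t (a : R) (p q p' q' : {poly R}) : I s -> I t ->
  cexp_poly s t p q -> cexp_poly s t p' q' ->
  cexp_poly s t (a *: p + p') (a *: q + q').
Proof.
move=> Is It h h' A pA; have mA := past_sub_measurable pA.
have lin u (f g : {poly R}) : I u -> \int[P]_(w in A) (a *: f + g).[X u w] =
    a * \int[P]_(w in A) f.[X u w] + \int[P]_(w in A) g.[X u w].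
  move=> Iu; under eq_Rintegral do rewrite hornerD hornerZ.
  rewrite RintegralD //; last 2 first.
  - have := integrable_poly_in (a *: f) Iu mA.
    by under eq_fun do rewrite /= hornerZ.
  - exact: integrable_poly_in.
  by rewrite RintegralZl //; exact: integrable_poly_in.
by rewrite !lin // h // h'.
Qed.

Lemma cexp_poly_tower s t u (p q r : {poly R}) : s <= t ->
  cexp_poly s t p q -> cexp_poly t u q r -> cexp_poly s u p r.
Proof.
by move=> st h h' A pA; rewrite h // h' //; exact: (past_mono st).
Qed.

(** Every support point is a root: near a non-root x, [p] keeps its sign and stays away from 0, so
    its integral over the preimage of a small ball, an event of positive probability, is nonzero. A
    nonzero polynomial has only finitely many roots. *)
Lemma infinite_support_poly0 (t : R) (p : {poly R}) : I t ->
  infinite_set (law_support P (X t)) ->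
  (forall A, past I X t A -> \int[P]_(w in A) p.[X t w] = 0) -> p = 0.
Proof.
move=> It infX p0; apply/eqP; apply: contrapT => /negP p_neq0; apply: infX.
suff roots x : law_support P (X t) x -> root p x.
  apply: contrapT => /(infinite_set_fset (size p)) [B Broots].
  rewrite leqNgt => /negP; apply.
  apply: max_poly_roots => //; last exact: fset_uniq.
  by apply/allP => x /Broots /roots.
move=> Sx; apply: contrapT => /negP px_neq0.
(* The factor [p.[x]] makes the value at x a positive square, whatever the sign of [p.[x]]. *)
pose q := p.[x] *: p.
have qx0 : 0 < q.[x] by rewrite hornerZ -expr2 exprn_even_gt0.
have /cvgrPdist_lt/(_ (q.[x] / 2)) : horner q y @[y --> x] --> q.[x].
  exact: continuous_horner.
rewrite divr_gt0 // => /(_ isT) /nbhs_ballP[e /= e0 qe].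
set A := X t @^-1` ball x e.
have pA : past I X t A by apply: past_preimage => //; exact: measurable_ball.
have mA := past_sub_measurable pA.
have : q.[x] / 2 * fine (P A) <= \int[P]_(w in A) q.[X t w].
  rewrite -Rintegral_cst //; apply: le_Rintegral => //.
  - exact: finite_measure_integrable_cst.
  - exact: integrable_poly_in.
  - move=> w /qe /=; rewrite ltr_norml => /andP[_].
    by rewrite ltrBlDr -ltrBlDl {1}(splitr q.[x]) addrK => /ltW.
under eq_Rintegral do rewrite hornerZ.
rewrite RintegralZl //; last exact: integrable_poly_in.
rewrite p0 // mulr0 leNgt => /negP; apply.
by rewrite mulr_gt0 ?divr_gt0 // fine_gt0 // Sx //= ltey_eq fin_num_measure.
Qed.

(** * Orthogonality and the use of TLI *)

Import HBNNSimple.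

(** Passes from indicators of events {Y in B} to simple functions of [Y] by linearity, then to [f]
    by monotone simple approximation and dominated convergence. This covers unbounded [f], as
    polynomials require. *)
Lemma integral_mul_comp0 (Y Z : T -> R) (f : R -> R) :
  measurable_fun setT Y -> P.-integrable setT (EFin \o Z) ->
  (forall B, measurable B -> \int[P]_(w in Y @^-1` B) Z w = 0) ->
  measurable_fun setT f -> (forall x, 0 <= f x) ->
  P.-integrable setT (fun w => (f (Y w) * Z w)%:E) ->
  \int[P]_w (f (Y w) * Z w) = 0.
Proof.
move=> mY iZ Z0 mf f0 ifZ.
have mZ : measurable_fun setT Z.
  by apply/measurable_EFinP; exact: measurable_int iZ.
have mEf : measurable_fun setT (EFin \o f) by exact/measurable_EFinP.
pose g := nnsfun_approx measurableT mEf.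
have gf x : EFin \o g^~ x @ \oo --> (f x)%:E.
  by apply: cvg_nnsfun_approx => // y _; rewrite /= lee_fin.
have g_le n x : g n x <= f x.
  rewrite /g nnsfun_approxE -lee_fin.
  by apply: le_approx => // y _; rewrite /= lee_fin.
have gZ0 n : (\int[P]_w (g n (Y w) * Z w)%:E)%E = 0%E.
  have iB (B : set R) (c : R) : measurable B ->
      P.-integrable setT (EFin \o (fun w => c * (Z \_ (Y @^-1` B)) w)).
    move=> mB; have mYB : measurable (Y @^-1` B).
      by rewrite -[_ @^-1` _]setTI; exact: mY.
    apply: (@integrableZl _ _ _ P _ measurableT c (EFin \o (Z \_ (Y @^-1` B)))).
    rewrite -restrict_EFin; apply/(integrable_mkcond _ mYB).1.
    exact: integrableS iZ.
  rewrite (_ : (fun w => _) = fun w => (\sum_(i < #|` fset_set (range (g n))|)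
     ((fset_set (range (g n)))`_i * 
        (Z \_ (Y @^-1` (g n @^-1` [set (fset_set (range (g n)))`_i]))) w)%:E)%E);
    last first.
    apply/funext => w; rewrite fimfunEord mulr_suml -sumEFin.
    apply: eq_bigr => i _; congr EFin; rewrite -mulrA; congr (_ * _).
    rewrite patchE indicE.
    have -> : (Y w \in g n @^-1` [set (fset_set (range (g n)))`_i]) =
       (w \in Y @^-1` (g n @^-1` [set (fset_set (range (g n)))`_i])) by [].
    by case: ifP => _; rewrite ?mul1r ?mul0r.
  rewrite integral_sum //; last by move=> i; exact: iB.
  apply: big1 => i _.
  set B := g n @^-1` _; have mB : measurable B by exact: measurable_funPTI.
  rewrite -[LHS]fineK; last by apply: integrable_fin_num => //; exact: iB.
  congr EFin.
  rewrite -[LHS]/(Rintegral _ _ _) RintegralZl //.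
    by rewrite -Rintegral_mkcond Z0 // mulr0.
  by have := iB B 1 mB; under eq_fun do rewrite /= mul1r.
(* Since 0 <= [g n] <= [f], the function [|f (Y w) * Z w|] dominates the whole sequence. *)
have [|||||_ _] := @dominated_convergence _ _ _ P _ measurableT
  (fun n w => (g n (Y w) * Z w)%:E) (fun w => (f (Y w) * Z w)%:E)
  (fun w => `|f (Y w) * Z w|%:E).
- move=> n; apply/measurable_EFinP; apply: measurable_funM => //.
  exact: measurableT_comp.
- apply/measurable_EFinP; apply: measurable_funM => //.
  exact: measurableT_comp.
- apply: aeW => w _.
  have := cvgeMr (y := (Z w)%:E) isT (gf (Y w)).
  by rewrite /comp.
- exact: integrable_norm ifZ.
- apply: aeW => w n _; rewrite lee_fin !normrM ler_wpM2r //.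
  by rewrite !ger0_norm.
rewrite (_ : [sequence _]_n = cst 0%E); last by apply/funext => n; exact: gZ0.
by rewrite /Rintegral => /(cvg_unique _ (cvg_cst _)) <-.
Qed.


Lemma Rintegral_polyM (n : nat) (p q : {poly R}) s t : I s -> I t ->
  (size p <= n)%N ->
  \int[P]_w (p.[X s w] * q.[X t w]) =
  \sum_(i < n) p`_i * \int[P]_w (X s w ^+ i * q.[X t w]).
Proof.
move=> Is It pn.
have iM i : P.-integrable setT (EFin \o (fun w => X s w ^+ i * q.[X t w])).
  have := integrable_polyM 'X^i q Is It.
  by under eq_fun do rewrite hornerXn.
have iMc i : P.-integrable setT
    (EFin \o (fun w => p`_i * (X s w ^+ i * q.[X t w]))).
  exact: (integrableZl measurableT p`_i (iM i)).
under eq_Rintegral do rewrite (horner_coef_wide _ pn) mulr_suml.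
transitivity (\sum_(i < n) \int[P]_w (p`_i * (X s w ^+ i * q.[X t w]))).
  rewrite /Rintegral sum_fine; last first.
    by move=> i _; apply: integrable_fin_num => //; exact: iMc.
  rewrite -integral_sum; [|by []|by move=> i; exact: iMc].
  congr fine; apply: eq_integral => w _.
  by rewrite sumEFin; congr EFin; apply: eq_bigr => i _; rewrite mulrA.
by apply: eq_bigr => i _; rewrite RintegralZl.
Qed.

Lemma Rintegral_setT_cst (a : R) : \int[P]_(w in setT) a = a.
Proof.
rewrite Rintegral_cst // -[RHS]mulr1; congr (_ * _).
by rewrite -[RHS]/(fine 1%E); congr fine; exact: (probability_setT P).
Qed.

(** Events {X_s in B} lie in the past of s, so [q.[X t w]] has zero integral over each of them and
    [integral_mul_comp0] applies to squares of polynomials in [X s]. *)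
Lemma cexp_poly0_orthogonal s t (p q : {poly R}) : I s -> I t ->
  cexp_poly s t 0 q -> \int[P]_w (p.[X s w] * q.[X t w]) = 0.
Proof.
move=> Is It q0.
have sq0 (f : {poly R}) : \int[P]_w ((f ^+ 2).[X s w] * q.[X t w]) = 0.
  apply: (integral_mul_comp0 (f := horner (f ^+ 2))).
  - exact: mX.
  - exact: integrable_poly.
  - move=> B mB; rewrite -q0; last exact: past_preimage.
    by under eq_Rintegral do rewrite horner0; rewrite Rintegral_cst ?mul0r //;
      rewrite -[_ @^-1` _]setTI; exact: mX.
  - by apply: continuous_measurable_fun => x; exact: continuous_horner.
  - by move=> x; rewrite horner_exp sqr_ge0.
  - exact: integrable_polyM.
(* [p] is a difference of squares, so the nonnegative case suffices. *)
pose h : {poly R} := (2^-1)%:P; pose f := h * (p + 1); pose g := h * (p - 1).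
have h2 : h * 2 = 1 by rewrite -[2]polyC_natr -polyCM mulVf.
have pE : p = f ^+ 2 - g ^+ 2.
  have -> : f ^+ 2 - g ^+ 2 = (h * 2) ^+ 2 * p by rewrite /f /g; ring.
  by rewrite h2 expr1n mul1r.
rewrite pE; under eq_Rintegral do rewrite hornerD hornerN mulrBl.
by rewrite RintegralB ?sq0 ?subr0 //; exact: integrable_polyM.
Qed.

(** For s = t, where TLI says nothing, infinite support suffices. Otherwise q(X_t) is uncorrelated
    with each X_s^j, 1 <= j <= N, so the non-constant coefficients of [q] form a row annihilated by
    the TLI matrix and vanish; orthogonality to 1 then removes the constant. *)
Lemma TLI_cexp_poly0 (N : nat) s t (q : {poly R}) : (0 < N)%N ->
  TLI P N I X -> infinite_set (law_support P (X t)) -> I s -> I t ->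
  (size q <= N.+1)%N -> cexp_poly s t 0 q -> q = 0.
Proof.
move=> N0 tli infX Is It qN q0.
have [st|st] := eqVneq s t.
  apply: (infinite_support_poly0 It infX) => A pA.
  rewrite st in q0; rewrite -(q0 _ pA).
  have mA := past_sub_measurable pA.
  by under eq_Rintegral do rewrite horner0; rewrite Rintegral_cst ?mul0r.
have ortho p := cexp_poly0_orthogonal p Is It q0.
pose c : 'rV[R]_N := \row_i q`_i.+1.
have := tli N; rewrite N0 leqnn => /(_ isT s t Is It st).
set C := \matrix_(_, _) _ => uC.
have cC0 : c *m C = 0.
  apply/rowP => j; rewrite !mxE.
  pose m (i : nat) := cov P (fun w => X t w ^+ i) (fun w => X s w ^+ j.+1).
  transitivity (\sum_(i < N.+1) q`_i * m i).
    rewrite big_ord_recl /=.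
    (* A constant has zero covariance with anything, so the sum may start at degree 0 and run over
       all coefficients of [q]. *)
    have -> : m 0%N = 0.
      rewrite /m /cov /expct -!/(Rintegral _ _ _).
      under eq_Rintegral do rewrite expr0 mul1r.
      under [X in _ - X * _]eq_Rintegral do rewrite expr0.
      by rewrite Rintegral_setT_cst mul1r subrr.
    by rewrite mulr0 add0r; apply: eq_bigr => i _; rewrite !mxE.
  (* The sum is E(q(X_t) X_s^(j+1)) - E q(X_t) E X_s^(j+1); [ortho] with 'X^(j+1) and with 1 kills
     both terms. *)
  rewrite /m /cov /expct -!/(Rintegral _ _ _).
  under eq_bigr do rewrite mulrBr mulrA.
  rewrite sumrB -mulr_suml.
  have := @Rintegral_polyM N.+1 q 'X^(j.+1) t s It Is qN.
  under eq_Rintegral do rewrite mulrC.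
  rewrite ortho => /esym.
  under eq_bigr do under eq_Rintegral do rewrite hornerXn.
  move=> ->; have := @Rintegral_polyM N.+1 q 1 t s It Is qN.
  under eq_Rintegral do rewrite mulrC.
  rewrite ortho => /esym.
  under eq_bigr do under eq_Rintegral do rewrite hornerE mulr1.
  by move=> ->; rewrite mul0r subr0.
have c0 : c = 0 by rewrite -[c](mulmxK uC) cC0 mul0mx.
have qE : q = (q`_0)%:P.
  apply/polyP => -[|i]; rewrite coefC //=.
  have [iN|Ni] := ltnP i N.
    by have /rowP/(_ (Ordinal iN)) := c0; rewrite !mxE.
  by rewrite nth_default // (leq_trans qN).
have := ortho 1; rewrite qE.
under eq_Rintegral do rewrite !hornerE.
by rewrite Rintegral_setT_cst => ->.
Qed.

(** * Uniqueness, polynomial martingales and the matrix form *)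

Lemma cexp_poly_unique s t (p p' q : {poly R}) : I s -> I t ->
  infinite_set (law_support P (X s)) ->
  cexp_poly s t p q -> cexp_poly s t p' q -> p = p'.
Proof.
move=> Is It infX h h'; apply/eqP; rewrite -subr_eq0; apply/eqP.
apply: (infinite_support_poly0 Is infX) => A pA.
have mA := past_sub_measurable pA.
under eq_Rintegral do rewrite hornerD hornerN.
by rewrite RintegralB ?h ?h' ?subrr //; exact: integrable_poly_in.
Qed.

Lemma cexp_poly_const s t (a : R) : cexp_poly s t a%:P a%:P.
Proof. by move=> A pA; apply: eq_Rintegral => w _; rewrite !hornerC. Qed.

Lemma martingale_polyP (p : R -> {poly R}) :
  martingale P I X (fun t w => (p t).[X t w]) <->
  forall s t, I s -> I t -> s <= t -> cexp_poly s t (p s) (p t).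
Proof.
split=> [[_ h] s t Is It st|h]; first exact/cexp_polyP/h.
split=> [t It|s t Is It st]; last exact/cexp_polyP/h.
by split; [exact: meas_wrt_poly|exact: integrable_poly].
Qed.

Lemma mulmx_Xvec (N : nat) (M : 'M[R]_N.+1) (i : 'I_N.+1) t w :
  (M *m Xvec N X t w) i 0 = (rVpoly (row i M)).[X t w].
Proof.
by rewrite horner_rVpoly_sum mxE; apply: eq_bigr => k _; rewrite !mxE.
Qed.

Lemma martingale_mxP (N : nat) (W : R -> 'M[R]_N.+1) (i : 'I_N.+1) :
  martingale P I X (fun t w => (W t *m Xvec N X t w) i 0) <->
  forall s t, I s -> I t -> s <= t ->
    cexp_poly s t (rVpoly (row i (W s))) (rVpoly (row i (W t))).
Proof.
rewrite -martingale_polyP.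
by under eq_fun do under eq_fun do rewrite mulmx_Xvec.
Qed.

Lemma cexp_poly_rows (N : nat) s t (B C : 'M[R]_N) (c : 'rV[R]_N) :
  I s -> I t ->
  (forall i, cexp_poly s t (rVpoly (row i B)) (rVpoly (row i C))) ->
  cexp_poly s t (rVpoly (c *m B)) (rVpoly (c *m C)).
Proof.
move=> Is It h; rewrite !mulmx_sum_row.
elim/big_rec2: _ => [|i x y _ ih].
  by rewrite !linear0; exact: cexp_poly_const.
by rewrite !linearD !linearZ /=; exact: cexp_poly_linear.
Qed.

(** Quantifying over all row vectors, not just basis rows, turns the tower property into
    associativity of [*m]. *)
Definition cexp_mx (N : nat) (s t : R) (M : 'M[R]_N) : Prop :=
  forall c : 'rV[R]_N, cexp_poly s t (rVpoly (c *m M)) (rVpoly c).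

Lemma cexp_mx_row (N : nat) s t (M : 'M[R]_N) (i : 'I_N) :
  cexp_mx s t M -> cexp_poly s t (rVpoly (row i M)) 'X^i.
Proof. by move=> h; rewrite rowE -rVpoly_delta; exact: h. Qed.

Lemma cexp_mx_unique (N : nat) s t (M M' : 'M[R]_N) : I s -> I t ->
  infinite_set (law_support P (X s)) ->
  cexp_mx s t M -> cexp_mx s t M' -> M = M'.
Proof.
move=> Is It infX h h'; apply/row_matrixP => i.
apply: (can_inj (@rVpolyK _ _)).
exact: (cexp_poly_unique Is It infX (cexp_mx_row i h) (cexp_mx_row i h')).
Qed.

Lemma cexp_mx_tower (N : nat) s t u (M M' : 'M[R]_N) : s <= t ->
  cexp_mx s t M -> cexp_mx t u M' -> cexp_mx s u (M' *m M).
Proof.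
move=> st h h' c; rewrite mulmxA; exact: cexp_poly_tower (h _) (h' c).
Qed.

Lemma TLI_cexp_mx_unit (N : nat) s t (M : 'M[R]_N.+1) : (0 < N)%N ->
  TLI P N I X -> infinite_set (law_support P (X t)) -> I s -> I t ->
  cexp_mx s t M -> M \in unitmx.
Proof.
move=> N0 tli infX Is It h; rewrite -row_free_unit; apply: inj_row_free => c cM.
apply: (can_inj (@rVpolyK _ _)); rewrite linear0.
apply: (TLI_cexp_poly0 N0 tli infX Is It); first exact: size_poly.
by have := h c; rewrite cM linear0.
Qed.

Lemma A_mx_trig (N : nat) gam (s t : R) : is_trig_mx (A_mx (R := R) N gam s t).
Proof.
apply/is_trig_mxP => i j ij; rewrite mxE.
case: eqP => [i0|_]; last by rewrite leqNgt ij.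
by case: eqP => // j0; rewrite i0 j0 in ij.
Qed.

Lemma horner_A_mx (N : nat) gam (s t x : R) (i : 'I_N.+1) : (0 < i)%N ->
  (rVpoly (row i (A_mx N gam s t))).[x] = \sum_(k < i.+1) gam i k s t * x ^+ k.
Proof.
move=> i0; rewrite horner_rVpoly_sum.
rewrite (big_ord_widen N.+1 (fun k => gam i k s t * x ^+ k)) //.
rewrite [RHS]big_mkcond /=.
apply: eq_bigr => k _; rewrite !mxE ltnS.
by rewrite eqn0Ngt i0 /=; case: leqP; rewrite ?mul0r.
Qed.

Lemma mpr_coeffsP (N : nat) gam :
  mpr_coeffs P N I X gam <->
  forall s t, I s -> I t -> s <= t -> cexp_mx s t (A_mx N gam s t).
Proof.
split=> [h s t Is It st c|h n /andP[n0 nN] s t Is It st].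
  rewrite -[in X in cexp_poly _ _ _ X](mulmx1 c).
  apply: cexp_poly_rows => // i; rewrite [row i 1%:M]rowE mulmx1 rVpoly_delta.
  (* [mpr_coeffs] starts at degree 1; row 0 of [A_mx] is the first basis vector and expresses E(1 |
     F) = 1. *)
  have [i0|i0] := posnP i.
    rewrite i0 expr0 (_ : rVpoly _ = 1); first exact: cexp_poly_const.
    rewrite -[RHS](rVpoly_delta R (ord0 : 'I_N.+1)); congr rVpoly.
    by apply/rowP => j; rewrite !mxE i0 eqxx.
  have /h/(_ s t Is It st) : (1 <= i <= N)%N by rewrite i0 -ltnS ltn_ord.
  rewrite -cexp_polyP //.
  under eq_fun do rewrite -hornerXn.
  by under [X in cexp_version _ _ _ X]eq_fun do rewrite -horner_A_mx //.
have nN1 : (n < N.+1)%N by [].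
have := cexp_mx_row (Ordinal nN1) (h s t Is It st).
rewrite -cexp_polyP //.
under eq_fun do rewrite hornerXn.
by under [X in cexp_version _ _ _ X]eq_fun do rewrite horner_A_mx //.
Qed.

(** * Structural matrices and martingales *)

Section StructuralMatrix.
Variable N : nat.
Hypothesis N0 : (0 < N)%N.
Hypothesis infX : forall t, I t -> infinite_set (law_support P (X t)).
Hypothesis tli : TLI P N I X.

(** Taking for c row i of V(t)^-1 in c A(s,t) = c V(t) V(s)^-1 cancels V(t) and leaves row i of
    V(s)^-1. *)
Lemma structural_matrix_martingale (V : R -> 'M[R]_N.+1) (i : 'I_N.+1) :
  structural_matrix P N I X V ->
  martingale P I X (fun t w => (invmx (V t) *m Xvec N X t w) i 0).
Proof.
move=> [Vls [gam [/mpr_coeffsP gamP AV]]]; apply/martingale_mxP => s t Is It st.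
have [[uVs _] [uVt _]] := (Vls s Is, Vls t It).
have := gamP s t Is It st (row i (invmx (V t))).
by rewrite AV // mulmxA -row_mul mulVmx // rowE mulmx1 -rowE.
Qed.

Section Converse.
Variable W : R -> 'M[R]_N.+1.
Hypothesis Wls : forall t, I t -> lower_nonsing N (W t).
Hypothesis Wmart : forall i : 'I_N.+1,
  martingale P I X (fun t w => (W t *m Xvec N X t w) i 0).

Lemma martingale_cexp_mx s t : I s -> I t -> s <= t ->
  cexp_mx s t (invmx (W t) *m W s).
Proof.
move=> Is It st c; have [uWt _] := Wls It.
rewrite -[c in X in cexp_poly _ _ _ X](mulmxKV uWt) mulmxA.
apply: cexp_poly_rows => // i; exact: (martingale_mxP W i).1.
Qed.

Lemma martingale_structural_matrix :
  structural_matrix P N I X (fun t => invmx (W t)).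
Proof.
split=> [t It|].
  have [uW tW] := Wls It; split; [by rewrite unitmx_inv|exact: invmx_trig].
(* [inord] only turns naturals into indices; [A_mx] reads [gam] within range, where [inord_val]
   undoes it. *)
pose gam n k s t := (invmx (W t) *m W s) (inord n) (inord k).
have AE s t : I s -> I t -> s <= t -> A_mx N gam s t = invmx (W t) *m W s.
  move=> Is It st.
  have [[uWs tWs] [uWt tWt]] := (Wls Is, Wls It).
  have /is_trig_mxP W0 := mulmx_trig (invmx_trig uWt tWt) tWs.
  (* [A_mx] prescribes row 0, so the product must be shown to have it: both rows represent E(1 |
     F_<=s), and infinite support makes that representation unique. *)
  have row0 : row ord0 (invmx (W t) *m W s) = delta_mx 0 ord0.
    apply: (can_inj (@rVpolyK _ _)); rewrite rVpoly_delta.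
    apply: (cexp_poly_unique Is It (infX Is)).
      exact: cexp_mx_row (martingale_cexp_mx Is It st).
    exact: cexp_poly_const.
  apply/matrixP => i j; rewrite mxE.
  case: ifP => [/eqP i0|_].
    have -> : i = ord0 by exact: val_inj.
    by have /rowP/(_ j) := row0; rewrite !mxE eqxx /= => ->.
  case: ifPn => [_|]; first by rewrite /gam !inord_val.
  by rewrite -ltnNge => ij; rewrite W0.
exists gam; split=> [|s u Is Iu su]; last by rewrite AE // invmxK.
apply/mpr_coeffsP => s t Is It st.
by rewrite AE //; exact: martingale_cexp_mx.
Qed.

End Converse.

(** [K] is the inverse of the structural family; its rows give martingales exactly because K(u)
    A(s,u) = K(s). *)
Lemma mpr_coeffs_martingales gam : mpr_coeffs P N I X gam ->
  exists K : R -> 'M[R]_N.+1,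
    (forall t, I t -> lower_nonsing N (K t)) /\
    forall i : 'I_N.+1,
      martingale P I X (fun t w => (rVpoly (row i (K t))).[X t w]).
Proof.
move=> /mpr_coeffsP gamP; set A := A_mx N gam in gamP.
have uA s t : I s -> I t -> s <= t -> A s t \in unitmx.
  move=> Is It st; apply: (TLI_cexp_mx_unit N0 tli (infX It) Is It).
  exact: gamP.
have AM s t u : I s -> I t -> I u -> s <= t -> t <= u -> A s u = A t u *m A s t.
  move=> Is It Iu st tu.
  apply: (cexp_mx_unique Is Iu (infX Is)); first exact/gamP/(le_trans st).
  exact: cexp_mx_tower (gamP _ _ Is It st) (gamP _ _ It Iu tu).
have [[t0 It0]|I0] := pselect (exists t0, I t0); last first.
  (* With [I] empty every requirement is vacuous, so the zero matrix serves. *)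
  by exists (fun=> 0); split=> [t It|i]; [|split=> [t It|s t Is]]; case: I0;
    [exists t|exists t|exists s].
(* [I] may lack a least element, hence times on both sides of [t0]. *)
pose K t := if t0 <= t then invmx (A t0 t) else A t t0.
(* Three cases: both times at or after [t0], [t0] between them, both before [t0]. Each is one use of
   the cocycle identity [AM]. *)
have KA s u : I s -> I u -> s <= u -> K u *m A s u = K s.
  move=> Is Iu su; rewrite /K; have [t0s|st0] := leP t0 s.
    have t0u := le_trans t0s su.
    rewrite t0u -[LHS](mulmxK (uA _ _ It0 Is t0s)) 
      -[_ *m A t0 s]mulmxA -AM // mulVmx ?uA //.
    by rewrite mul1mx.
  have [t0u|/ltW ut0] := leP t0 u; last by rewrite -AM // (le_trans su).
  by rewrite (AM s t0 u) ?(ltW st0) // mulKmx // uA.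
exists K; split=> [t It|i].
  rewrite /K; have [t0t|/ltW tt0] := leP t0 t.
    split; first by rewrite unitmx_inv uA.
    exact/invmx_trig/A_mx_trig/uA.
  by split; [exact: uA|exact: A_mx_trig].
apply/martingale_polyP => s t Is It st.
by have := gamP s t Is It st (row i (K t)); rewrite -row_mul KA.
Qed.

End StructuralMatrix.

End PolynomialMoments.

Theorem theorem1 (d : measure_display) (T : measurableType d) (R : realType)
    (P : probability T R) (l r : \bar R) (X : R -> T -> R) (N : nat) :
  let I := segment l r in
  (0 < N)%N ->
  (forall t, I t -> measurable_fun setT (X t)) ->
  (forall t (n : nat), I t -> P.-integrable setT (fun w => (`|X t w| ^+ n)%:E)) ->
  (forall t, I t -> infinite_set (law_support P (X t))) ->
  is_markov P I X -> TLI P N I X -> MSC P N I X ->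
  [/\
   (* X is N-MPR iff there are N polynomial martingales of degrees 1..N *)
   (MPR P N I X <->
    exists p : nat -> R -> {poly R},
      forall i : nat, (1 <= i <= N)%N ->
        (forall t, I t -> size (p i t) = i.+1) /\
        martingale P I X (fun t w => (p i t).[X t w])),
   (* entries of V_N^{-1}(t) X_t^{(N)} are martingales *)
   (forall V : R -> 'M[R]_N.+1, MPR P N I X -> structural_matrix P N I X V ->
      forall i : 'I_N.+1,
        martingale P I X (fun t w => (invmx (V t) *m Xvec N X t w) i 0)) &
   (* converse, with V_N = W_N^{-1} *)
   (forall W : R -> 'M[R]_N.+1,
      (forall t, I t -> lower_nonsing N (W t)) ->
      (forall i : 'I_N.+1,
         martingale P I X (fun t w => (W t *m Xvec N X t w) i 0)) ->
      [/\ (forall s t, I s -> I t -> s <= t -> forall i : 'I_N.+1,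
             cexp_version P (past I X s) (fun w => X t w ^+ i)
               (fun w => (invmx (W t) *m W s *m Xvec N X s w) i 0)),
          MPR P N I X &
          structural_matrix P N I X (fun t => invmx (W t))])].
Proof.
move=> I N0 mX moments infX markovX tli msc.
have converse (W : R -> 'M[R]_N.+1) :
    (forall t, I t -> lower_nonsing N (W t)) ->
    (forall i : 'I_N.+1,
       martingale P I X (fun t w => (W t *m Xvec N X t w) i 0)) ->
    structural_matrix P N I X (fun t => invmx (W t)).
  exact: martingale_structural_matrix.
(* The Markov property, TLI and MSC are assumed, so only the coefficients remain to be supplied. *)
have structural_MPR V : structural_matrix P N I X V -> MPR P N I X.
  by move=> [_ [gam [gamP _]]]; split => //; exists gam.
split; last first.
- move=> W Wls Wmart; have VW := converse W Wls Wmart.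
  split=> [s t Is It st i||//]; last exact: structural_MPR VW.
  have := cexp_mx_row i (martingale_cexp_mx mX moments Wls Wmart Is It st).
  rewrite -(cexp_polyP mX moments) //.
  under eq_fun do rewrite hornerXn.
  by under [X in cexp_version _ _ _ X]eq_fun do rewrite -mulmx_Xvec.
- by move=> V _ SV i; exact: structural_matrix_martingale.
split=> [[_ _ _ [gam gamP]]|[p pP]].
  have [K [Kls Kmart]] := mpr_coeffs_martingales mX moments N0 infX tli gamP.
  exists (fun i t => rVpoly (row (inord i : 'I_N.+1) (K t))) => i /andP[_ iN].
  split=> [t It|]; last exact: Kmart.
  by have [uK tK] := Kls t It; rewrite size_rVpoly_trig // inordK.
(* The constant martingale 1 is adjoined as row 0, completing the N given ones to a square
   matrix. *)
pose q (i : nat) t : {poly R} := if i == 0%N then 1 else p i t.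
have sq (i : 'I_N.+1) t : I t -> size (q i t) = i.+1.
  move=> It; rewrite /q; case: eqP => [->|/eqP]; first by rewrite size_poly1.
  by rewrite -lt0n => i0; apply: (pP i _).1 => //; rewrite i0 -ltnS ltn_ord.
pose W t : 'M[R]_N.+1 := \matrix_i poly_rV (q i t).
apply: structural_MPR; apply: (converse W) => [t It|i].
  (* Exact degree i in row i makes [W t] lower triangular with the nonzero leading coefficients on
     its diagonal. *)
  have tW : is_trig_mx (W t).
    by apply/is_trig_mxP => i j ij; rewrite !mxE nth_default // sq.
  split => //; rewrite unitmxE unitfE (det_trig tW).
  apply/prodf_neq0 => i _; rewrite !mxE.
  have -> : (q i t)`_i = lead_coef (q i t) by rewrite lead_coefE sq.
  by rewrite lead_coef_eq0 -size_poly_gt0 sq.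
apply/(martingale_mxP mX moments) => s t Is It st.
rewrite !rowK !poly_rV_K ?sq // /q; case: eqP => [_|/eqP].
  exact: cexp_poly_const.
rewrite -lt0n => i0.
have iN : (1 <= i <= N)%N by rewrite i0 -ltnS ltn_ord.
by have [_ /(martingale_polyP mX moments)] := pP i iN; exact.
Qed.
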